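(* Let $k,r\in\mathbb{N}$ and let $k_1,\ldots,k_r$ be integers with $1\le k_1<k_2<\cdots<k_r=k$. Let $\varphi_1,\ldots,\varphi_r\in\mathbb{Z}[z_1,\ldots,z_k]$ be symmetric polynomials of the shape \[ \varphi_j(\mathbf{z})=\sum_{l=1}^k a_{jl}\sigma_l(\mathbf{z})\quad(1\le j\le r), \] with fixed coefficients $a_{jl}\in\mathbb{Z}$, having respective degrees $\deg(\varphi_j)=k_j$ $(1\le j\le r)$. Then for each $\varepsilon>0$, \[ N_k(X;\boldsymbol{\varphi})=T_k(X)+O\bigl(X^{w(\boldsymbol{\varphi})+1+\varepsilon}\bigr). \] In particular, when $k_1+\cdots+k_r\ge \tfrac12 k(k-1)+2$, one has, for each $\varepsilon>0$, \[ N_k(X;\boldsymbol{\varphi})=k!\,X^k+O\bigl(X^{k-1+\varepsilon}\bigr). \]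
   Context: The elementary symmetric polynomials $\sigma_j(\mathbf{z})\in\mathbb{Z}[z_1,\ldots,z_k]$ $(0\le j\le k)$ are defined by $\sum_{j=0}^k\sigma_j(\mathbf{z})t^{k-j}=\prod_{i=1}^k(t+z_i)$. $N_k(X;\boldsymbol{\varphi})$ denotes the number of integral solutions of the system $\varphi_j(x_1,\ldots,x_k)=\varphi_j(y_1,\ldots,y_k)$ $(1\le j\le r)$ with $1\le x_i,y_i\le X$ $(1\le i\le k)$. $T_k(X)$ denotes the number of pairs $(\mathbf{x},\mathbf{y})$ of integral $k$-tuples with $1\le x_i,y_i\le X$ $(1\le i\le k)$ for which there is a permutation $\pi$ of $\{1,\ldots,k\}$ with $y_i=x_{\pi i}$ $(1\le i\le k)$ (the trivial, or diagonal, solutions). $w(\boldsymbol{\varphi})=\tfrac12 k(k+1)-k_1-k_2-\cdots-k_r$. $X$ is a sufficiently large positive number, and implicit constants in the $O$-notation may depend on $\varepsilon$, $k$ and the coefficients of $\boldsymbol{\varphi}=(\varphi_1,\ldots,\varphi_r)$. *)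

(* Defs.v *)
From mathcomp Require Import all_boot all_order all_fingroup all_algebra.
From mathcomp Require Import mpoly.
From mathcomp Require Import reals.

Set Implicit Arguments.
Unset Strict Implicit.
Unset Printing Implicit Defensive.

Import Order.TTheory GRing.Theory Num.Theory.

Local Open Scope ring_scope.

Definition sigma (k l : nat) : {mpoly int[k]} := mesym k int l.

(* The generating identity
   sum_j sigma_j(z) t^(k-j) = prod_i (t + z_i), with t the variable of {poly _}. *)
Lemma sigma_gen k :
  \sum_(j < k.+1) sigma k j *: 'X^(k - j)
  = \prod_(i < k) ('X + ('X_i : {mpoly int[k]})%:P) :> {poly {mpoly int[k]}}.
Proof.
under [RHS]eq_bigr do rewrite addrC.
rewrite (bigA_distr _ _).
rewrite (partition_big (fun J : {set 'I_k} => inord #|J| : 'I_k.+1) xpredT) //=.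
apply: eq_bigr => j _; rewrite /sigma /mesym scaler_suml.
have cJ (J : {set 'I_k}) : (#|J| < k.+1)%N.
  by rewrite ltnS -[X in (_ <= X)%N](card_ord k) max_card.
apply: eq_big => [J|J /eqP <-]; first by rewrite -val_eqE /= inordK.
rewrite big_if /= -rmorph_prod /= mul_polyC; congr (_ *: _).
rewrite prodr_const; congr ('X^_).
transitivity #|~: J|; last by apply: eq_card => i; rewrite !inE.
by rewrite cardsCs setCK card_ord.
Qed.

(* msize p is 1 + the total degree of p when p != 0, and msize 0 = 0,
   so has_degree p d entails p != 0. *)
Definition has_degree (k : nat) (p : {mpoly int[k]}) (d : nat) : bool :=
  msize p == d.+1.

Section Counting.
Variables (R : realType) (k r : nat).
Implicit Types (X : R) (phi : 'I_r -> {mpoly int[k]}).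

(* Integral k-tuples with coordinates in [0, X]; the counts below add the
   condition 1 <= x_i. The bound X is a real number (not necessarily an
   integer): natural numbers n <= X are those with n <= truncn X. *)
Definition tup X := {ffun 'I_k -> 'I_(Num.truncn X).+1}.

Lemma tup_bound X (n : nat) :
  0 <= X -> (n < (Num.truncn X).+1)%N = (n%:R <= X).
Proof. by move=> X0; rewrite ltnS truncn_ge_nat. Qed.

Definition positive X (x : tup X) : bool := [forall i, (1 <= x i)%N].

Definition evalZ X (p : {mpoly int[k]}) (x : tup X) : int :=
  p.@[fun i => (x i)%:Z].

Definition Nk phi X : nat :=
  #|[set xy : tup X * tup X |
      [&& positive xy.1, positive xy.2
        & [forall j, evalZ (phi j) xy.1 == evalZ (phi j) xy.2]]]|.

Definition Tk X : nat :=
  #|[set xy : tup X * tup X |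
      [&& positive xy.1, positive xy.2
        & [exists s : 'S_k, [forall i, xy.2 i == xy.1 (s i)]]]]|.

End Counting.

Arguments Tk {R} k X.

(* w(phi) in terms of the degrees kd j of the phi_j. *)
Definition weight (R : fieldType) (k r : nat) (kd : 'I_r -> nat) : R :=
  (k%:R * (k%:R + 1)) / 2 - \sum_(j < r) (kd j)%:R.
Arguments weight R k {r} kd.

(* Main.v *)
Require Import Defs.
From mathcomp Require Import all_boot all_order all_fingroup all_algebra.
From mathcomp Require Import -(notations) mpoly.
From mathcomp Require Import all_classical all_reals all_analysis.
From mathcomp Require Import zify ring lra.

Import Order.TTheory GRing.Theory Num.Theory.
Import numFieldNormedType.Exports.

(** Attach to a k-tuple x the polynomial Q_x = prod_i (T - x_i).  Its
    coefficients are, up to sign, the values sigma_l(x), and Q_x = Q_y exactly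
    when y is a permutation of x.  So a solution (x, y) is non-trivial exactly
    when H = Q_x - Q_y is not zero, and N_k - T_k counts the solutions with
    H <> 0.

    There are few possible H.  Put h_l = sigma_l(x) - sigma_l(y), which is
    O(X^l).  Since phi_j has degree k_j, the equation phi_j(x) = phi_j(y) is a
    linear relation between the h_l with l <= k_j in which h_(k_j) occurs.  The
    relations are thus triangular, and the h_l whose index l is not one of the
    k_j determine all the others (triangular_eq0).  These free h_l take at most
    O(X^w) values altogether, since w is the sum of the free indices l
    (sum_missing, weightE).

    Each H <> 0 comes from O(X^(1 + eps)) pairs (card_rpoly_sub).  Since Q_y
    vanishes at y_j, one has H(y_j) = prod_i (y_j - x_i).  If some value
    v = y_j is not a root of H, then, once v is chosen (O(X) ways), every
    v - x_i divides the fixed non-zero integer H(v), so the divisor bound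
    leaves O(X^eps) tuples x, and y consists of roots of Q_x - H.  If all the
    y_j are roots of H, there are O(1) tuples y, and x consists of roots of
    Q_y + H.  This gives O(X^(w + 1 + eps)) non-trivial solutions.

    The bounds are kept in the natural numbers as long as possible: instead of
    d(n) = O(n^eps) the divisor bound is stated as d(n)^m <= C n for every m
    (size_divisors_expn), and the number of non-trivial solutions is bounded
    through its m-th power (card_nontrivial_expn).  Real exponents appear only
    when m is chosen large in terms of eps (powR_bound_of_expn).

    For the second claim, the degree condition says that w + 1 <= k - 1, and
    T_k(X) = k! X^k + O(X^(k-1)) since all but O(X^(k-1)) tuples have distinct
    entries and thus exactly k! rearrangements (Tk_asymp). *)

(** * Counting by successive choices, and the divisor bound *)

(** Choosing first f u, in S, and then g u, in a set of at most m elements that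
    may depend on the first choice. *)
Lemma card_le_fibres {U T1 T2 : finType} (A : {pred U}) (f : U -> T1)
    (g : U -> T2) (S : {pred T1}) (P : T1 -> {pred T2}) m :
  {in A &, injective (fun u => (f u, g u))} ->
  {in A, forall u, (f u \in S) && (g u \in P (f u))} ->
  {in S, forall x, #|P x| <= m} -> #|A| <= #|S| * m.
Proof.
move=> inj_fg fgA leP.
pose Q := [set xy : T1 * T2 | (xy.1 \in S) && (xy.2 \in P xy.1)].
have /leq_trans-> // : #|A| <= #|Q|.
  rewrite -(card_in_imset inj_fg); apply: subset_leq_card.
  by apply/fintype.subsetP => _ /imsetP[u uA ->]; rewrite inE fgA.
rewrite -sum1_card (eq_bigl (fun xy : T1 * T2 => (xy.1 \in S) && (xy.2 \in P xy.1)));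
  last by move=> xy; rewrite inE.
rewrite -(pair_big_dep (mem S) (fun x y => y \in P x) (fun _ _ => 1)) /=.
rewrite -sum_nat_const; apply: leq_sum => x xS.
by rewrite sum1_card leP.
Qed.

(** Exponentials beat powers, with the explicit constant needed for the divisor
    bound: a + 1 <= m (a / m + 1) <= m 2^(a / m). *)
Lemma leq_succ_expn {m} a : 0 < m -> (a.+1) ^ m <= m ^ m * 2 ^ a.
Proof.
move=> m_gt0; have [q_ r_] := (leq_divM a m, ltn_pmod a m_gt0).
have /leq_trans-> // : a.+1 ^ m <= (m * 2 ^ (a %/ m)) ^ m.
  rewrite leq_exp2r //; apply: (@leq_trans (m * (a %/ m).+1)).
    by rewrite mulnS {1}(divn_eq a m) mulnC; lia.
  by rewrite leq_pmul2l // ltn_expl.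
by rewrite expnMn leq_pmul2l ?expn_gt0 ?m_gt0 // -expnM leq_exp2l.
Qed.

(** A divisor of n is the product of a power of p and of a divisor of the
    prime-to-p part of n. *)
Lemma size_divisors_partn p n : prime p -> 0 < n ->
  size (divisors n) <= (logn p n).+1 * size (divisors n`_p^').
Proof.
move=> p_pr n_gt0.
pose s := [seq p ^ i * d | i <- iota 0 (logn p n).+1, d <- divisors n`_p^'].
suff /(uniq_leq_size (divisors_uniq n)) : {subset divisors n <= s}.
  by rewrite size_allpairs size_iota.
move=> d; rewrite -dvdn_divisors // => d_n.
have d_gt0 := dvdn_gt0 n_gt0 d_n.
rewrite -(partnC p d_gt0) p_part; apply: allpairs_f.
  by rewrite mem_iota /= ltnS dvdn_leq_log.
by rewrite -dvdn_divisors ?part_gt0 // partn_dvd.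
Qed.

(** The divisor bound d(n) = O(n^(1/m)).  Removing the largest prime p of n,
    with exponent a, costs a factor (a + 1)^m on the left and gains p^a on the
    right.  When p >= 2^m this costs nothing, since (a + 1)^m <= 2^(a m) <= p^a;
    each of the fewer than 2^m smaller primes costs at most m^m. *)
Lemma size_divisors_expn m : 0 < m ->
  exists C, forall n, 0 < n -> size (divisors n) ^ m <= C * n.
Proof.
move=> m_gt0; exists ((m ^ m) ^ (2 ^ m)).
have c_gt0 : 0 < m ^ m by rewrite expn_gt0 m_gt0.
suff bound B n : 0 < n -> (forall p, prime p -> p %| n -> p < B) ->
    size (divisors n) ^ m <= (m ^ m) ^ minn B (2 ^ m) * n.
  move=> n n_gt0; apply: leq_trans (bound n.+1 n n_gt0 _) _.
    by move=> p _ /(dvdn_leq n_gt0); rewrite ltnS.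
  by rewrite leq_mul2r leq_pexp2l ?geq_minr ?orbT.
(* Induction on the bound B for the primes of n: the p-part is removed for p = B. *)
elim: B n => [|B IHB] n n_gt0 ltB.
  rewrite min0n mul1n; have [->|n_neq1] := eqVneq n 1; first by rewrite exp1n.
  have n_gt1 : 1 < n by lia.
  by have := ltB _ (pdiv_prime n_gt1) (pdiv_dvd n).
have [Bn|Bn] := boolP (prime B && (B %| n)); last first.
  apply: (@leq_trans ((m ^ m) ^ minn B (2 ^ m) * n)).
    apply: IHB => // p p_pr p_n; have := ltB p p_pr p_n.
    rewrite ltnS leq_eqVlt => /orP[/eqP pB|//].
    by rewrite -pB p_pr p_n in Bn.
  by rewrite leq_mul2r leq_pexp2l ?orbT //; lia.
have [B_pr {}Bn] := andP Bn.
set a := logn B n; set n' := n`_B^'.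
have defn : B ^ a * n' = n by rewrite -p_part partnC.
have n'_gt0 : 0 < n' by exact: part_gt0.
have IH : size (divisors n') ^ m <= (m ^ m) ^ minn B (2 ^ m) * n'.
  apply: IHB => // p p_pr p_n'.
  have : p <= B by rewrite -ltnS ltB // -defn dvdn_mull.
  rewrite leq_eqVlt => /orP[/eqP pB|//].
  have := part_pnat B^' n; rewrite -/n' /pnat n'_gt0 /= => /allP/(_ B).
  rewrite -pB mem_primes p_pr n'_gt0 p_n' => /(_ isT).
  by rewrite !inE eqxx.
have /leq_trans-> // : size (divisors n) ^ m
    <= a.+1 ^ m * ((m ^ m) ^ minn B (2 ^ m) * n').
  rewrite (leq_trans _ (leq_mul (leqnn _) IH)) // -expnMn leq_exp2r //.
  exact: size_divisors_partn.
have cX_gt0 j : 0 < (m ^ m) ^ j by rewrite expn_gt0 c_gt0.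
have a_gt0 : 0 < a by rewrite /a logn_gt0 mem_primes B_pr n_gt0.
have [leB|ltB2] := leqP (2 ^ m) B.
  have -> : minn B.+1 (2 ^ m) = 2 ^ m by lia.
  rewrite mulnCA -defn leq_pmul2l // leq_pmul2r //.
  apply: (@leq_trans ((2 ^ a) ^ m)); first by rewrite leq_exp2r // ltn_expl.
  by rewrite -expnM mulnC expnM leq_exp2r.
have -> : minn B.+1 (2 ^ m) = B.+1 by lia.
rewrite mulnCA -defn expnSr -mulnA leq_pmul2l // mulnA leq_pmul2r //.
apply: leq_trans (leq_succ_expn a m_gt0) _.
by rewrite leq_pmul2l // leq_exp2r ?prime_gt1.
Qed.

Local Open Scope ring_scope.

(** * Root polynomials *)

Definition rpoly {k N} (x : {ffun 'I_k -> 'I_N}) : {poly int} :=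
  \prod_(i < k) ('X - ((x i)%:Z)%:P).

Definition sigma_at {k N} (x : {ffun 'I_k -> 'I_N}) (l : nat) : int :=
  mpoly.meval (fun i => (x i)%:Z) (sigma k l).

Section RootPolynomial.
Context {k N : nat}.
Implicit Types (x y : {ffun 'I_k -> 'I_N}).

(** Vieta's formulas. *)
Lemma coef_rpoly x l : (l <= k)%N -> (rpoly x)`_(k - l) = (-1) ^+ l * sigma_at x l.
Proof.
move=> lk; have := mroots_coeff [tuple (x i)%:Z | i < k] (Ordinal (lk : (l < k.+1)%N)).
rewrite big_tuple /rpoly /=; under eq_bigr do rewrite tnth_mktuple.
by move=> ->; congr (_ * _); apply: meval_eq => i; rewrite tnth_mktuple.
Qed.

Lemma size_rpoly x : size (rpoly x) = k.+1.
Proof. by rewrite size_prod_XsubC /index_enum -enumT size_enum_ord. Qed.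

Lemma rpoly_neq0 x : rpoly x != 0.
Proof. by rewrite -size_poly_eq0 size_rpoly. Qed.

Lemma root_rpoly x i : root (rpoly x) (x i)%:Z.
Proof. by rewrite rootE horner_prod (bigD1 i) //= !hornerE subrr mul0r. Qed.

Lemma sigma_at_ge0 x l : 0 <= sigma_at x l.
Proof.
rewrite /sigma_at /sigma /mesym raddf_sum sumr_ge0 // => h _.
rewrite /= rmorph_prod prodr_ge0 //= => i _; by rewrite mevalXU.
Qed.

(** The values of the elementary symmetric polynomials and the root polynomial
    carry the same information; this lemma and the next translate between
    them. *)
Lemma sigma_at_eq_rpoly x y : rpoly x = rpoly y ->
  forall l, (l <= k)%N -> sigma_at x l = sigma_at y l.
Proof.
move=> eq_xy l lk; have := coef_rpoly x l lk.
by rewrite eq_xy coef_rpoly // => /(mulfI (negbT (signr_eq0 _ _))).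
Qed.

Lemma rpoly_sub_eq x y x' y' :
  (forall l : 'I_k, sigma_at x l.+1 - sigma_at y l.+1 = sigma_at x' l.+1 - sigma_at y' l.+1) ->
  rpoly x - rpoly y = rpoly x' - rpoly y'.
Proof.
move=> eq_d; apply/polyP => i; rewrite !coefB.
have [ik|ki] := leqP i k; last first.
  by rewrite !nth_default ?size_rpoly.
rewrite -(subKn ik) !coef_rpoly ?leq_subr // -!mulrBr.
case: (posnP (k - i)) => [->|]; last first.
  case: (k - i)%N (leq_subr i k) => // l lk _.
  by rewrite (eq_d (Ordinal lk)).
have e0 z : sigma_at z 0 = 1 by rewrite /sigma_at /sigma mesym0E meval1.
by rewrite !e0.
Qed.

(** Over the rationals, unique factorization recovers the multiset of roots. *)
Lemma rpoly_perm x y : rpoly x = rpoly y -> exists s : 'S_k, forall i, y i = x (s i).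
Proof.
move=> eq_xy; pose t (z : {ffun 'I_k -> 'I_N}) := [tuple (z i : nat)%:Q | i < k] : k.-tuple rat.
have Et z : \prod_(c <- t z) ('X - c%:P) = map_poly intr (rpoly z).
  rewrite big_tuple rmorph_prod; apply: eq_bigr => i _.
  by rewrite tnth_mktuple rmorphB /= map_polyX map_polyC.
have /prod_XsubC_eq/tuple_permP[s Es] :
  \prod_(c <- t y) ('X - c%:P) = \prod_(c <- t x) ('X - c%:P) by rewrite !Et eq_xy.
exists s => i; have := congr1 (fun u => nth 0 u i) Es.
by rewrite -!tnth_nth !tnth_mktuple => /intr_inj[] /val_inj.
Qed.

End RootPolynomial.

(** Each of the at most 2^k terms of sigma_l is at most N^l. *)
Lemma sigma_at_le {k N} (x : {ffun 'I_k -> 'I_N.+1}) l :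
  sigma_at x l <= (2 ^ k * N ^ l)%N%:Z.
Proof.
rewrite /sigma_at /sigma /mesym raddf_sum /=.
apply: (@le_trans _ _ (\sum_(h : {set 'I_k} | #|h| == l) (N ^ l)%N%:Z)).
  apply: ler_sum => h /eqP <-; rewrite rmorph_prod /=.
  apply: (@le_trans _ _ (\prod_(i in h) N%:Z)); last first.
    by rewrite prodr_const -natz -natrX natz.
  apply: ler_prod => i _; rewrite mevalXU /= lez_nat.
  by rewrite -ltnS ltn_ord.
rewrite sumr_const -mulr_natl -!natz natrM ler_wpM2r ?ler0n // ler_nat.
rewrite -[X in (_ <= 2 ^ X)%N]card_ord -cardsT -card_powerset.
by rewrite powersetT cardsT max_card.
Qed.

(** The factor 2 accounts for the sign of v - u. *)
Lemma card_near_divisors N (v m : nat) : (0 < m)%N ->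
  (#|[pred u : 'I_N | `|v%:Z - u%:Z| %| m]| <= 2 * size (divisors m))%N.
Proof.
move=> m_gt0; set A := [pred u | _].
rewrite cardE -(size_map val).
apply: (@leq_trans (size ([seq (v + d)%N | d <- divisors m] ++
                          [seq (v - d)%N | d <- divisors m]))); last first.
  by rewrite size_cat !size_map mul2n addnn.
apply: uniq_leq_size; first by rewrite map_inj_uniq ?enum_uniq //; exact: val_inj.
move=> x /mapP[u]; rewrite mem_enum inE (dvdn_divisors _ m_gt0) => uP ->.
rewrite mem_cat; have [uv|vu] := leqP u v; apply/orP; [right|left];
  apply/mapP; exists `|v%:Z - u%:Z|%N; rewrite //=; lia.
Qed.

Lemma card_root_ord N (p : {poly int}) n : p != 0 -> (size p <= n.+1)%N ->
  (#|[pred v : 'I_N | root p v%:Z]| <= n)%N.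
Proof.
move=> p_neq0 le_n; rewrite -ltnS; apply: leq_trans le_n.
rewrite cardE -(size_map (fun v : 'I_N => v%:Z)); apply: max_poly_roots => //.
  by apply/allP => _ /mapP[v + ->]; rewrite mem_enum inE.
by rewrite map_inj_uniq ?enum_uniq // => u v [] /val_inj.
Qed.

(** A bound may be proved from a member of the set, the empty set being trivial. *)
Lemma card_le_witness {T : finType} (A : {pred T}) m :
  (forall x, x \in A -> (#|A| <= m)%N) -> (#|A| <= m)%N.
Proof. by move=> leA; case: (pickP (mem A)) => [x /leA //|/eq_card0->]. Qed.

Lemma card_rpoly_eq k N (p : {poly int}) :
  (#|[pred x : {ffun 'I_k -> 'I_N} | rpoly x == p]| <= k ^ k)%N.
Proof.
apply: card_le_witness => x0 /eqP defp.
have sub : [pred x : {ffun 'I_k -> 'I_N} | rpoly x == p]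
    \subset ffun_on [pred v : 'I_N | root p v%:Z].
  apply/fintype.subsetP => x /eqP <-; apply/ffun_onP => i.
  by rewrite inE root_rpoly.
apply: leq_trans (subset_leq_card sub) _; rewrite card_ffun_on card_ord.
have: (#|[pred v : 'I_N | root p v%:Z]| <= k)%N.
  by apply: card_root_ord; rewrite -defp ?rpoly_neq0 ?size_rpoly.
by case: (k) => // k'; rewrite leq_exp2r.
Qed.

Lemma dist_ord_le N (u v : 'I_N.+1) : (`|v%:Z - u%:Z| <= N)%N.
Proof. by case: u v => a + [b] /=; lia. Qed.

(** A non-zero difference H of root polynomials comes from few pairs (x, y).
    The first choice is the value v of an entry of y that is not a root of H,
    or the absence of such an entry, which gives N + 2 possibilities. *)
Lemma card_rpoly_sub k N D (H : {poly int}) : H != 0 -> (0 < D)%N ->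
  (forall n, (0 < n <= N ^ k)%N -> (size (divisors n) <= D)%N) ->
  (#|[pred xy : {ffun 'I_k -> 'I_N.+1} * {ffun 'I_k -> 'I_N.+1} |
       (rpoly xy.1 - rpoly xy.2 == H)%R]| <= N.+2 * ((2 * k.+1 * D) ^ k * k ^ k))%N.
Proof.
move=> H_neq0 D_gt0 leD.
have leX a b : (a <= b -> a ^ k <= b ^ k)%N.
  by case: (k) => // k' ab; rewrite leq_exp2r.
pose f (xy : {ffun 'I_k -> 'I_N.+1} * {ffun 'I_k -> 'I_N.+1}) :=
  [pick v | (v \in codom xy.2) && ~~ root H v%:Z].
(* The factor 2 (k + 1) D dominates both 2 D, for the choice of an entry of x when
   v exists, and k, for the choice of an entry of y among the roots of H. *)
rewrite -[X in (X.+1 * _)%N]card_ord -card_option.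
apply: (card_le_fibres _ f id predT
  (fun o => [pred xy | (rpoly xy.1 - rpoly xy.2 == H) && (f xy == o)])).
- by move=> ? ? _ _ [].
- by move=> xy; rewrite !inE => ->; rewrite eqxx.
move=> o _; apply: card_le_witness => -[x0 y0]; rewrite inE /= => /andP[/eqP defH].
have size_H : (size H <= k.+1)%N.
  by rewrite -defH (leq_trans (size_polyD _ _)) // size_polyN !size_rpoly maxnn.
case: o => [v|] /eqP f0.
  have vH : ~~ root H v%:Z by move: f0; rewrite /f; case: pickP => // u /andP[_ uH] [<-].
  have y0v : v \in codom y0 by move: f0; rewrite /f; case: pickP => // u /andP[uy _] [<-].
  have Hv (x y : {ffun 'I_k -> 'I_N.+1}) : rpoly x - rpoly y = H -> v \in codom y ->
      `|H.[v%:Z]|%N = \prod_(i < k) `|v%:Z - (x i)%:Z|%N.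
    move=> <- /codomP[j ->]; rewrite hornerD hornerN (eqP (root_rpoly y j)) subr0.
    rewrite horner_prod (big_morph absz abszM absz1).
    by apply: eq_bigr => i _; rewrite !hornerE.
  set z := `|H.[v%:Z]|%N in Hv.
  have z_gt0 : (0 < z)%N by rewrite absz_gt0.
  have z_le : (z <= N ^ k)%N.
    rewrite (Hv x0 y0) // -[k in X in (_ <= X)%N]card_ord -prod_nat_const.
    by apply: leq_prod => i _; apply: dist_ord_le.
  (* The entries of x lie at a distance dividing z from v. *)
  pose S := [pred u : 'I_N.+1 | `|v%:Z - u%:Z|%N %| z]%N.
  apply: (@leq_trans (#|(ffun_on S : {pred {ffun 'I_k -> 'I_N.+1}})| * k ^ k)); last first.
    rewrite leq_mul2r card_ffun_on card_ord leX ?orbT //.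
    apply: leq_trans (card_near_divisors _ _ _ z_gt0) _.
    rewrite -mulnA leq_mul2l /= (leq_trans (leD z _)) ?z_gt0 ?z_le //.
    by rewrite leq_pmull.
  apply: (card_le_fibres _ fst snd _ (fun x => [pred y | rpoly y == rpoly x - H])).
  - by move=> [? ?] [? ?] _ _ [-> ->].
  - move=> [x y]; rewrite inE /= => /andP[/eqP xyH /eqP fxy].
    rewrite [X in _ && X]inE -xyH subKr eqxx andbT; apply/ffun_onP => i; rewrite inE.
    have vy : v \in codom y by move: fxy; rewrite /f; case: pickP => // u /andP[uy _] [<-].
    by rewrite (Hv x y) // (bigD1 i) //= dvdn_mulr.
  by move=> x _; apply: card_rpoly_eq.
have yH (x y : {ffun 'I_k -> 'I_N.+1}) : f (x, y) = None -> forall i, root H (y i)%:Z.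
  by rewrite /f; case: pickP => // + _ i => /(_ (y i)); rewrite codom_f => /negbFE.
(* Here every entry of y is a root of H, so y is chosen before x. *)
pose S := [pred u : 'I_N.+1 | root H u%:Z].
apply: (@leq_trans (#|(ffun_on S : {pred {ffun 'I_k -> 'I_N.+1}})| * k ^ k)); last first.
  rewrite leq_mul2r card_ffun_on card_ord leX ?orbT //.
  by apply: leq_trans (card_root_ord _ _ _ H_neq0 size_H) _; nia.
apply: (card_le_fibres _ snd fst _ (fun y => [pred x | rpoly x == rpoly y + H])).
- by move=> [? ?] [? ?] _ _ [-> ->].
- move=> [x y]; rewrite inE /= => /andP[/eqP xyH /eqP fxy].
  rewrite [X in _ && X]inE -xyH addrC subrK eqxx andbT; apply/ffun_onP => i.
  by rewrite inE (yH x).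
by move=> x _; apply: card_rpoly_eq.
Qed.

(** * The triangular system *)

Lemma mdeg_mesymlm k (l : 'I_k) : mdeg (mesymlm k l.+1) = l.+1.
Proof.
rewrite mdeg_mesym1 -sum1dep_card (big_ord_narrow (ltn_ord l)).
by rewrite sum_nat_const card_ord muln1.
Qed.

(** The polynomials sigma_1, ..., sigma_k involve pairwise disjoint sets of
    monomials, so a coefficient of a linear combination sees one term only. *)
Lemma mcoeff_sigma_comb k (c : 'I_k -> int) (m : multinom k) :
  mcoeff m (\sum_(i < k) c i *: sigma k i.+1) =
  \sum_(i < k | mdeg m == i.+1) c i * [forall j, (m j <= 1)%N]%:R.
Proof.
rewrite raddf_sum [RHS]big_mkcond; apply: eq_bigr => i _ /=.
by rewrite mcoeffZ mcoeff_mesym /mechar; case: (mdeg m == i.+1); rewrite ?mulr0.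
Qed.

(** Since sigma_l is homogeneous of degree l, no cancellation can occur: the
    degree of a combination is the largest l that occurs in it. *)
Lemma degree_sigma_comb k (c : 'I_k -> int) p d :
  p = \sum_(i < k) c i *: sigma k i.+1 -> has_degree p d ->
  (forall l : 'I_k, (d <= l)%N -> c l = 0) /\
  (exists2 l : 'I_k, l.+1 = d & c l != 0).
Proof.
move=> defp /eqP size_d; split=> [l dl|].
  have: mcoeff (mesymlm k l.+1) p = 0.
    apply: memN_msupp_eq0; apply: msize_mdeg_ge.
    by rewrite size_d mdeg_mesymlm.
  rewrite defp mcoeff_sigma_comb mdeg_mesymlm (big_pred1 l).
    case: forallP => [_|[]]; first by rewrite mulr1.
    by move=> i; rewrite mnmE; case: (_ \in _).
  by move=> i /=; rewrite eqSS eq_sym.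
have p_neq0 : p != 0 by rewrite -msize_poly_eq0 size_d.
have := p_neq0; rewrite -mleadc_eq0 [in X in mcoeff _ X]defp mcoeff_sigma_comb.
have := mlead_deg p_neq0; rewrite size_d => -[->].
have [l /andP[/eqP ld cl] _|c_d /negP[]] := pickP [pred l : 'I_k | (l.+1 == d) && (c l != 0)].
  by exists l.
rewrite big1 // => l /eqP dl; have := c_d l; rewrite /= dl eqxx => /negbFE/eqP ->.
by rewrite mul0r.
Qed.

(** Each equation determines the unknown of index kd j in terms of the unknowns
    of lower index; the remaining unknowns vanish by assumption. *)
Lemma triangular_eq0 k r (kd : 'I_r -> nat) (a : 'M[int]_(r, k)) (d : 'I_k -> int) :
  (forall j (l : 'I_k), (kd j <= l)%N -> a j l = 0) ->
  (forall j, exists2 l : 'I_k, l.+1 = kd j & a j l != 0) ->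
  (forall j, \sum_(l < k) a j l * d l = 0) ->
  (forall l : 'I_k, (forall j, kd j != l.+1) -> d l = 0) ->
  forall l, d l = 0.
Proof.
move=> a0 a_lead sum0 d0 l.
have [n] := ubnP (val l); elim: n l => // n IHn l /=; rewrite ltnS => le_n.
have [/existsP[j /eqP kdj]|] := boolP [exists j, kd j == l.+1]; last first.
  by rewrite negb_exists => /forallP/d0.
have [l' l'E al'] := a_lead j; have {l'E} El : l' = l.
  by apply: val_inj; move: l'E; rewrite kdj => -[].
have := sum0 j; rewrite (bigD1 l) //= big1 => [/eqP|i il].
  by rewrite addr0 mulf_eq0 -El (negPf al') /= => /eqP.
have [il'|li] := ltnP i l; first by rewrite (IHn i) ?mulr0 // (leq_trans il').
rewrite a0 ?mul0r // kdj ltn_neqAle li andbT.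
by apply: contra il => /eqP/val_inj ->.
Qed.

(** * Counting non-trivial solutions *)

(** The degrees in 1..k that are not of the form kd j; their sum is the exponent
    w of the theorem.  As 'I_k starts at 0, the index l stands for degree l + 1. *)
Definition missing {k r} (kd : 'I_r -> nat) : {pred 'I_k} :=
  fun l => [forall j, kd j != l.+1].

(** The solutions that are not permutations of each other.  Entries
    range over 0, ..., N - 1, so that for N - 1 the integer part of X this set
    contains the non-trivial solutions of the theorem. *)
Definition nontrivial {k r} (a : 'M[int]_(r, k)) N :
    {pred {ffun 'I_k -> 'I_N} * {ffun 'I_k -> 'I_N}} :=
  [pred xy | (rpoly xy.1 != rpoly xy.2) &&
    [forall j, \sum_(l < k) a j l * (sigma_at xy.1 l.+1 - sigma_at xy.2 l.+1) == 0]].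

Section Nontrivial.
Context {k r : nat} (kd : 'I_r -> nat) (a : 'M[int]_(r, k)).
Hypothesis a_above : forall j (l : 'I_k), (kd j <= l)%N -> a j l = 0.
Hypothesis a_lead : forall j, exists2 l : 'I_k, l.+1 = kd j & a j l != 0.

(** The product bounds the number of differences H of root polynomials: these
    are determined by the values of sigma_l(x) - sigma_l(y) for the missing
    degrees l, each of which lies between - 2^k N^l and 2^k N^l. *)
Lemma card_nontrivial N D : (0 < D)%N ->
  (forall n, (0 < n <= N ^ k)%N -> (size (divisors n) <= D)%N) ->
  (#|nontrivial a N.+1| <=
   (\prod_(l < k | missing kd l) (2 * (2 ^ k * N ^ l.+1)).+1) *
   (N.+2 * ((2 * k.+1 * D) ^ k * k ^ k)))%N.
Proof.
move=> D_gt0 leD.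
pose B (l : 'I_k) := (if missing kd l then 2 * (2 ^ k * N ^ l.+1) else 0)%N.
pose h (xy : {ffun 'I_k -> 'I_N.+1} * {ffun 'I_k -> 'I_N.+1}) (l : 'I_k) : int :=
  sigma_at xy.1 l.+1 - sigma_at xy.2 l.+1.
(* The differences are shifted by 2^k N^l, which makes them natural numbers. *)
pose code xy : {dffun forall l : 'I_k, 'I_(B l).+1} :=
  [ffun l => inord `|(h xy l + (2 ^ k * N ^ l.+1)%N%:Z)%R|%N].
have -> : (\prod_(l < k | missing kd l) (2 * (2 ^ k * N ^ l.+1)).+1)%N =
    #|{: {dffun forall l : 'I_k, 'I_(B l).+1}}|.
  rewrite card_dep_ffun foldrE big_map big_enum /= [LHS]big_mkcond.
  by apply: eq_bigr => l _; rewrite card_ord /B; case: ifP.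
have h_code xy xy' l : missing kd l -> code xy = code xy' -> h xy l = h xy' l.
  move=> l_miss /ffunP/(_ l); rewrite !ffunE => /(congr1 val).
  have hB z : (`|(h z l + (2 ^ k * N ^ l.+1)%N%:Z)%R| < (B l).+1)%N /\
      0 <= h z l + (2 ^ k * N ^ l.+1)%N%:Z.
    rewrite /h /B l_miss.
    have := sigma_at_le z.1 l.+1; have := sigma_at_le z.2 l.+1.
    have := sigma_at_ge0 z.1 l.+1; have := sigma_at_ge0 z.2 l.+1.
    move: (2 ^ k * N ^ l.+1)%N (sigma_at _ _) (sigma_at _ _) => M e e'; lia.
  rewrite /= !inordK; [|by case: (hB xy')|by case: (hB xy)].
  have [_ p] := hB xy; have [_ p'] := hB xy'.
  by move/(congr1 Posz); rewrite !gez0_abs // => /addIr.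
apply: (card_le_fibres _ code id predT
  (fun c => [pred xy | (xy \in nontrivial a N.+1) && (code xy == c)])).
- by move=> ? ? _ _ [].
- by move=> xy; rewrite !inE => ->; rewrite eqxx.
move=> c _; apply: card_le_witness => xy0; rewrite !inE => /andP[/andP[nt0 /forallP sol0] /eqP c0].
have H_neq0 : rpoly xy0.1 - rpoly xy0.2 != 0 by rewrite subr_eq0.
apply: leq_trans (card_rpoly_sub _ _ _ _ H_neq0 D_gt0 leD).
apply: subset_leq_card; apply/fintype.subsetP => xy.
rewrite !inE => /andP[/andP[nt /forallP sol] /eqP cxy].
apply/eqP; apply: rpoly_sub_eq => l; apply/eqP.
rewrite -/(h xy l) -/(h xy0 l) -subr_eq0; apply/eqP; move: l.
apply: (triangular_eq0 _ _ kd a) => // [j|l l_miss].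
  under eq_bigr do rewrite mulrBr.
  by rewrite sumrB (eqP (sol j)) (eqP (sol0 j)) subrr.
by rewrite (h_code xy xy0) ?subrr ?cxy //; apply/forallP.
Qed.

Lemma card_nontrivial_expn m : (0 < m)%N -> exists C, forall N, (0 < N)%N ->
  (#|nontrivial a N.+1| ^ m <=
   C * N ^ (m * (\sum_(l < k | missing kd l) l.+1).+1 + k * k))%N.
Proof.
move=> m_gt0; have [C leC] := size_divisors_expn m m_gt0.
set w := (\sum_(l < k | _) _)%N.
(* 2 (2^k N^l) + 1 <= 2^(k+2) N^l for each missing degree, and N + 2 <= 3 N. *)
exists ((((2 ^ k.+2) ^ k) * (3 * ((2 * k.+1) ^ k * k ^ k))) ^ m * C ^ k)%N => N N_gt0.
have NX_gt0 j : (0 < N ^ j)%N by rewrite expn_gt0 N_gt0.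
(* The largest number of divisors in the relevant range is attained, so that its
   m-th power inherits the divisor bound. *)
pose D := (\max_(n < N ^ k) size (divisors n.+1))%N.
have [|n0 D_n0] := bigop.eq_bigmax (fun n : 'I_(N ^ k) => size (divisors n.+1)).
  by rewrite card_ord.
rewrite -/D in D_n0.
have leD n : (0 < n <= N ^ k)%N -> (size (divisors n) <= D)%N.
  by case: n => // n lt_n; rewrite -[n]/(val (Ordinal lt_n)) leq_bigmax.
have D_gt0 : (0 < D)%N by apply: leq_trans (leD 1%N _); rewrite // NX_gt0.
have D_le : (D ^ m <= C * N ^ k)%N.
  by rewrite D_n0 (leq_trans (leC _ _)) // leq_mul2l ltn_ord orbT.
have le_prod : (\prod_(l < k | missing kd l) (2 * (2 ^ k * N ^ l.+1)).+1
    <= (2 ^ k.+2) ^ k * N ^ w)%N.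
  rewrite /w expn_sum.
  apply: (@leq_trans (\prod_(l < k | missing kd l) (2 ^ k.+2 * N ^ l.+1))%N).
    apply: leq_prod => l _; rewrite 2!(expnS 2) -!mulnA.
    have : (0 < 2 ^ k * N ^ l.+1)%N by rewrite muln_gt0 expn_gt0 NX_gt0.
    lia.
  rewrite big_split /= leq_mul2r prod_nat_const leq_pexp2l ?orbT //.
    by rewrite expn_gt0.
  by rewrite -[X in (_ <= X)%N]card_ord max_card.
have le1 : (#|nontrivial a N.+1| <=
    ((2 ^ k.+2) ^ k * (3 * ((2 * k.+1) ^ k * k ^ k))) * N ^ w.+1 * D ^ k)%N.
  apply: leq_trans (card_nontrivial N D D_gt0 leD) _.
  apply: leq_trans (leq_mul le_prod (leqnn _)) _.
  apply: (@leq_trans ((2 ^ k.+2) ^ k * N ^ w * (3 * N * ((2 * k.+1 * D) ^ k * k ^ k)))%N).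
    by rewrite leq_mul2l leq_mul2r; apply/orP; right; apply/orP; right; lia.
  by rewrite expnMn (expnSr N); apply: eq_leq; ring.
rewrite -(leq_exp2r _ _ m_gt0) in le1; apply: leq_trans le1 _.
rewrite !(expnMn _ _ m) -!expnM -!mulnA !leq_mul2l; do 4 (apply/orP; right).
rewrite (mulnC w.+1) expnD mulnCA leq_mul2l; apply/orP; right.
rewrite (mulnC k m) !expnM -expnMn.
by case: (k) D_le => // k' D_le; rewrite leq_exp2r.
Qed.

Lemma sum_missing : injective kd ->
  (\sum_(l < k | missing kd l) l.+1 + \sum_(j < r) kd j = \sum_(l < k) l.+1)%N.
Proof.
move=> kd_inj; have kd_lt j : ((kd j).-1 < k)%N by case: (a_lead j) => l <- _; exact: ltn_ord.
pose e j := Ordinal (kd_lt j).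
have eE j : (e j).+1 = kd j by rewrite /=; case: (a_lead j) => l <- _.
rewrite [RHS](bigID (missing kd)) /=; congr (_ + _)%N.
rewrite (eq_bigr (fun j => (e j).+1)) => [|j _]; last by rewrite eE.
rewrite -(big_imset (fun l : 'I_k => l.+1)) => [|i j _ _ eij]; last first.
  by apply: kd_inj; rewrite -!eE eij.
apply: eq_bigl => l; rewrite negb_forall; apply/imsetP/existsP => -[j].
  by move=> _ ->; exists j; rewrite negbK eE.
by rewrite negbK => /eqP kdj; exists j => //; apply: val_inj; rewrite /= kdj.
Qed.

End Nontrivial.

Local Open Scope classical_set_scope.
Local Open Scope ring_scope.

(** * Trivial solutions *)

(** All but O(n^(k-1)) of the k-tuples over n letters have distinct entries; the
    extra factor n avoids the exponent k - 1. *)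
Lemma expn_ffact_le n k : (n * n ^ k <= n * n ^_ k + k ^ 2 * n ^ k)%N.
Proof.
elim: k => [|k IHk]; first by rewrite ffactn0 expn0 !muln1 leq_addr.
have ffX : (n ^_ k <= n ^ k)%N.
  by elim: k {IHk} => // k IHk; rewrite ffactnSr expnSr leq_mul ?leq_subr.
have le_n : (n * n ^_ k <= n ^_ k.+1 + k * n ^_ k)%N.
  by rewrite ffactnSr (mulnC (n ^_ k)) -mulnDl leq_mul2r; apply/orP; right; lia.
rewrite expnS; move: (n ^ k)%N (n ^_ k)%N (n ^_ k.+1)%N IHk ffX le_n => X F F'.
move=> H1 H2 H3; apply: (@leq_trans (n * (n * F) + n * (k ^ 2 * X))%N); first nia.
apply: (@leq_trans (n * (F' + k * F) + n * (k ^ 2 * X))%N); first nia.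
have : (n * (k * F) <= n * (k * X))%N by rewrite !leq_mul2l H2 !orbT.
rewrite !expnS expn0; nia.
Qed.

Section Comparison.
Context {R : realType} {k r : nat} (a : 'M[int]_(r, k))
  (phi : 'I_r -> mpoly.mpoly k int).
Hypothesis phiE : forall j : 'I_r, phi j = \sum_(l < k) a j l *: sigma k l.+1.

Lemma evalZ_sigma_at (X : R) j (x : tup k X) :
  evalZ (phi j) x = \sum_(l < k) a j l * sigma_at x l.+1.
Proof.
rewrite /evalZ phiE raddf_sum; apply: eq_bigr => l _.
by rewrite /= mevalZ.
Qed.

(** Permuting the entries does not change the root polynomial, and so the
    trivial pairs are solutions; the other solutions have distinct root
    polynomials. *)
Lemma Nk_Tk_bounds (X : R) :
  (Tk k X <= Nk phi X <= Tk k X + #|nontrivial a (Num.truncn X).+1|)%N.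
Proof.
rewrite /Tk /Nk; set ST := finset.finset _; set SN := finset.finset _.
have solE (xy : tup k X * tup k X) :
   [forall j, evalZ (phi j) xy.1 == evalZ (phi j) xy.2] =
   [forall j, \sum_(l < k) a j l * (sigma_at xy.1 l.+1 - sigma_at xy.2 l.+1) == 0].
  apply: eq_forallb => j; rewrite !evalZ_sigma_at -subr_eq0 -sumrB.
  by congr (_ == 0); apply: eq_bigr => l _; rewrite mulrBr.
have STN : ST \subset SN.
  apply/fintype.subsetP => -[x y]; rewrite !inE /= => /and3P[-> -> /existsP[s /forallP ys]] /=.
  have Exy : rpoly x = rpoly y.
    rewrite /rpoly (reindex_inj (@perm_inj _ s)); apply: eq_bigr => i _.
    by rewrite (eqP (ys i)).
  rewrite (solE (x, y)); apply/forallP => j; rewrite big1 // => l _ /=.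
  by rewrite (sigma_at_eq_rpoly _ _ Exy) ?subrr ?mulr0.
rewrite subset_leq_card //= -(cardsID ST SN) (finset.setIidPr STN) leq_add2l.
apply: subset_leq_card; apply/fintype.subsetP => -[x y].
rewrite !inE /= => /andP[nT /and3P[px py sol]]; rewrite px py /= in nT.
rewrite -(solE (x, y)) sol andbT; apply: contra nT => /eqP /rpoly_perm[s ys].
by apply/existsP; exists s; apply/forallP => i; rewrite ys.
Qed.

End Comparison.

Section TrivialSolutions.
Context {R : realType} (k : nat) (X : R).
Let N := Num.truncn X.
Let pos : {pred 'I_N.+1} := [pred i : 'I_N.+1 | (0 < i)%N].

Let card_pos : #|pos| = N.
Proof.
rewrite -sum1_card big_mkcond big_ord_recl /= add0n.
by rewrite sum_nat_const card_ord muln1.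
Qed.

Let positiveE (x : tup k X) : positive x = (x \in ffun_on pos).
Proof. by apply/forallP/ffun_onP. Qed.

Let act (sx : 'S_k * tup k X) : tup k X * tup k X := (sx.2, [ffun i => sx.2 (sx.1 i)]).

(** Upper and lower bounds for the number of trivial solutions: pairs (s, x) of a
    permutation and a tuple are mapped onto them by act, and injectively when
    the entries of x are distinct. *)
Lemma Tk_le : (Tk k X <= k`! * N ^ k)%N.
Proof.
pose A := finset.setX [set: 'S_k] [set x : tup k X | x \in ffun_on pos].
have -> : (k`! * N ^ k)%N = #|A|.
  rewrite cardsX cardsT card_Sn; congr (_ * _)%N.
  by rewrite cardsE card_ffun_on card_pos card_ord.
apply: leq_trans (leq_imset_card act A).
apply: subset_leq_card; apply/fintype.subsetP => -[x y].
rewrite !inE /= positiveE => /and3P[px _ /existsP[s /forallP ys]].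
apply/imsetP; exists (s, x); first by rewrite !inE.
by rewrite /act /=; congr (_, _); apply/ffunP => i; rewrite ffunE (eqP (ys i)).
Qed.

Lemma le_Tk : (k`! * N ^_ k <= Tk k X)%N.
Proof.
pose I := finset.finset (fun x : tup k X => (x \in ffun_on pos) && injectiveb x).
have inI x : (x \in I) = (x \in ffun_on pos) && injectiveb x by rewrite finset.in_set.
pose A := finset.setX [set: 'S_k] I.
have -> : (k`! * N ^_ k)%N = #|A|.
  rewrite cardsX cardsT card_Sn /I card_inj_ffuns_on.
  by rewrite card_pos card_ord.
rewrite -(@card_in_imset _ _ act A) => [|[s x] [t y]].
  apply: subset_leq_card; apply/fintype.subsetP => xy /imsetP[[s x]].
  rewrite finset.in_setX => /andP[_]; rewrite inI => /andP[px _] ->.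
  rewrite finset.inE /= !positiveE px /=.
  apply/andP; split; last by apply/existsP; exists s; apply/forallP => i; rewrite ffunE.
  by apply/ffun_onP => i; rewrite ffunE (ffun_onP px).
rewrite finset.in_setX => /andP[_]; rewrite inI => /andP[_ /injectiveP inj_x].
move=> _ [<- /ffunP Est]; congr (_, _).
by apply/permP => i; have := Est i; rewrite !ffunE => /inj_x.
Qed.

End TrivialSolutions.

(** * Asymptotics *)

Lemma weightE (R : realType) k r (kd : 'I_r -> nat) (a : 'M[int]_(r, k)) :
  (forall j, exists2 l : 'I_k, l.+1 = kd j & a j l != 0) -> injective kd ->
  weight R k kd = (\sum_(l < k | missing kd l) l.+1)%N%:R.
Proof.
move=> a_lead kd_inj; rewrite /weight -natr_sum.
have sumS n : (\sum_(l < n) l.+1)%N%:R = n%:R * (n%:R + 1) / 2 :> R.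
  elim: n => [|n IHn]; first by rewrite big_ord0 !mul0r.
  by rewrite big_ord_recr /= natrD IHn -natr1; field.
by rewrite -sumS -(sum_missing kd a a_lead kd_inj) natrD addrK.
Qed.

(** A bound for all m-th powers with an error b in the exponent that does not
    depend on m is a bound with an arbitrarily small loss eps: take m >= b / eps. *)
Lemma powR_bound_of_expn (R : realType) (f : nat -> nat) (q b : nat) :
  (forall m, (0 < m)%N -> exists C : nat, forall N, (0 < N)%N ->
     (f N ^ m <= C * N ^ (m * q + b))%N) ->
  forall eps : R, 0 < eps -> exists2 C : R, 0 < C & forall X, 1 <= X ->
    (f (Num.truncn X))%:R <= C * X `^ (q%:R + eps).
Proof.
move=> fP eps eps_gt0.
pose m := (Num.truncn (b%:R / eps)).+1.
have b_le : b%:R <= m%:R * eps.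
  rewrite -ler_pdivrMr //; apply: ltW.
  by case/andP: (truncn_itv (divr_ge0 (ler0n R b) (ltW eps_gt0))).
have [C leC] := fP m isT; exists C.+1%:R => // X X_ge1.
have X_ge0 : 0 <= X by exact: le_trans X_ge1.
set N := Num.truncn X.
have N_gt0 : (0 < N)%N by rewrite truncn_gt0.
have NX : N%:R <= X by rewrite truncn_le.
rewrite -(@ler_pXn2r _ m) // ?nnegrE ?mulr_ge0 ?powR_ge0 //.
rewrite -natrX; apply: (@le_trans _ _ (C * N ^ (m * q + b))%N%:R).
  by rewrite ler_nat leC.
rewrite natrM natrX exprMn; apply: ler_pM; rewrite ?exprn_ge0 //.
  by rewrite -natrX ler_nat (leq_trans (leqnSn C)) // -{1}[C.+1]expn1 leq_pexp2l.
rewrite -[leRHS]powR_mulrn ?powR_ge0 // -powRrM.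
apply: (@le_trans _ _ (X ^+ (m * q + b))); first by rewrite lerXn2r ?nnegrE.
rewrite -powR_mulrn //; apply: ler_powR => //.
by rewrite natrD natrM mulrDl (mulrC q%:R) lerD2l (mulrC eps).
Qed.

(** One error term k X^(k-1) comes from replacing X by its integer part, the
    other, k^2 X^(k-1), from the tuples with a repeated entry. *)
Lemma Tk_asymp (R : realType) k (X : R) : (0 < k)%N -> 1 <= X ->
  `|(Tk k X)%:R - (k`!)%:R * X ^+ k| <= (k`! * (k ^ 2 + k))%N%:R * X ^+ k.-1.
Proof.
case: k => // k _ X_ge1; rewrite [_.-1]/=.
have X_ge0 : 0 <= X by exact: le_trans X_ge1.
have := Tk_le k.+1 X; have := le_Tk k.+1 X; set N := Num.truncn X => le_T T_le.
have N_gt0 : (0 < N)%N by rewrite truncn_gt0.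
have /andP[NX XN] : N%:R <= X < N.+1%:R := truncn_itv X_ge0.
have ff : (N ^ k.+1 <= N ^_ k.+1 + k.+1 ^ 2 * N ^ k)%N.
  have := expn_ffact_le N k.+1.
  by rewrite [in X in (_ + X)%N](expnS N) mulnCA -mulnDr leq_pmul2l.
have NXk j : N%:R ^+ j <= X ^+ j by rewrite lerXn2r ?nnegrE.
have XNk : X ^+ k.+1 - N%:R ^+ k.+1 <= k.+1%:R * X ^+ k.
  rewrite subrXX -[leRHS]mul1r; apply: ler_pM.
  - by rewrite subr_ge0.
  - by apply: sumr_ge0 => i _; rewrite mulr_ge0 ?exprn_ge0.
  - by rewrite lerBlDr addrC natr1 ltW.
  apply: (@le_trans _ _ (\sum_(i < k.+1) X ^+ k)); last first.
    by rewrite sumr_const card_ord mulr_natl.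
  apply: ler_sum => i _.
  have -> : X ^+ k = X ^+ (k - i) * X ^+ i by rewrite -exprD subnK ?leq_ord.
  by rewrite ler_wpM2l ?NXk ?exprn_ge0.
rewrite distrC ger0_norm; last first.
  rewrite subr_ge0 (le_trans (_ : _ <= (k.+1`! * N ^ k.+1)%N%:R)) ?ler_nat //.
  by rewrite natrM natrX ler_wpM2l.
have {le_T T_le} le_T : (k.+1`! * N ^_ k.+1)%N%:R <= (Tk k.+1 X)%:R :> R by rewrite ler_nat.
apply: (@le_trans _ _ (k.+1`!%:R * (X ^+ k.+1 - (N ^_ k.+1)%:R))).
  by rewrite mulrBr -natrM lerD2l lerN2.
rewrite natrM -mulrA ler_wpM2l // natrD mulrDl.
rewrite -(ler_nat R) natrD natrM !natrX in ff.
have : (k.+1 ^ 2)%N%:R * N%:R ^+ k <= (k.+1 ^ 2)%N%:R * X ^+ k by rewrite ler_wpM2l.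
rewrite natrX; lra.
Qed.

Theorem theorem1p1 (R : realType) (k r : nat) (kd : 'I_r -> nat)
    (a : 'M[int]_(r, k)) (phi : 'I_r -> mpoly.mpoly k int)
    (k_gt0 : (0 < k)%N) (r_gt0 : (0 < r)%N)
    (kd_ge1 : forall j : 'I_r, (1 <= kd j)%N)
    (kd_incr : forall i j : 'I_r, (i < j)%N -> (kd i < kd j)%N)
    (kd_last : forall j : 'I_r, j.+1 = r -> kd j = k)
    (phi_sym : forall j : 'I_r, phi j \is mpoly.symmetric)
    (phiE : forall j : 'I_r, phi j = \sum_(l < k) a j l *: sigma k l.+1)
    (phi_deg : forall j : 'I_r, has_degree (phi j) (kd j)) :
  (forall eps : R, 0 < eps ->
     exists2 C : R, 0 < C & \forall X \near +oo,
       `|(Nk phi X)%:R - (Tk k X)%:R| <= C * X `^ (weight R k kd + 1 + eps))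
  /\
  ((k%:R * (k%:R - 1)) / 2 + 2 <= \sum_(j < r) (kd j)%:R :> R ->
   forall eps : R, 0 < eps ->
     exists2 C : R, 0 < C & \forall X \near +oo,
       `|(Nk phi X)%:R - (k`!)%:R * X ^+ k| <= C * X `^ (k%:R - 1 + eps)).
Proof.
have a_deg j := degree_sigma_comb _ _ _ _ (phiE j) (phi_deg j).
have a_above j := (a_deg j).1; have a_lead j := (a_deg j).2.
have kd_inj : injective kd.
  move=> i j eq_kd; apply: val_inj.
  by case: (ltngtP i j) => // /kd_incr; rewrite eq_kd ltnn.
have paucity (eps : R) : 0 < eps -> exists2 C : R, 0 < C & forall X, 1 <= X ->
    `|(Nk phi X)%:R - (Tk k X)%:R| <= C * X `^ (weight R k kd + 1 + eps).
  move=> eps_gt0; rewrite (weightE _ _ _ _ _ a_lead kd_inj) natr1.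
  have [C C_gt0 leC] := powR_bound_of_expn R _ _ _
    (card_nontrivial_expn kd a a_above a_lead) eps eps_gt0.
  exists C => // X X_ge1; apply: le_trans (leC X X_ge1).
  have /andP[TN NT] := Nk_Tk_bounds a phi phiE X.
  by rewrite -natrB // ger0_norm // ler_nat leq_subLR.
split=> [eps eps_gt0|deg_ge eps eps_gt0].
  have [C C_gt0 leC] := paucity eps eps_gt0; exists C => //.
  near=> X; apply: leC; near: X; exact: nbhs_pinfty_ge.
have [C C_gt0 leC] := paucity eps eps_gt0.
exists (C + (k`! * (k ^ 2 + k))%N%:R); first by rewrite ltr_wpDr.
near=> X.
have X_ge1 : 1 <= X by near: X; exact: nbhs_pinfty_ge.
have le_w : weight R k kd + 1 + eps <= k%:R - 1 + eps by rewrite /weight; lra.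
rewrite -(subrKA (Tk k X)%:R) (le_trans (ler_normD _ _)) // mulrDl lerD //.
  by apply: le_trans (leC X X_ge1) _; rewrite ler_wpM2l ?(ltW C_gt0) ?ler_powR.
apply: le_trans (Tk_asymp _ _ _ k_gt0 X_ge1) _; rewrite ler_wpM2l //.
rewrite -powR_mulrn ?(le_trans ler01) // ler_powR // -subn1 natrB //.
by rewrite lerDl ltW.
Unshelve. all: by end_near. Qed.
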